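(* Let $\Gamma$ be a finite group and let $\mathcal D=\oplus_{g\in\Gamma}\mathcal D_g$ be a $\Gamma$-extension of a tensor category $\mathcal C$ (so $\mathcal C=\mathcal D_e$). If $\mathcal D$ is a braided tensor category, then $\mathcal C$ is a braided tensor category.
   Context: The base field $\Bbbk$ is algebraically closed of characteristic zero. A finite tensor category is a locally finite, $\Bbbk$-linear, rigid, monoidal abelian category $\mathcal D$ with $\operatorname{End}_{\mathcal D}(\mathbf 1)\cong\Bbbk$. A (faithful) $\Gamma$-grading on a finite tensor category $\mathcal D$ is a decomposition $\mathcal D=\oplus_{g\in\Gamma}\mathcal D_g$ into full abelian subcategories with $\mathcal D_g\neq0$ and $\otimes:\mathcal D_g\times\mathcal D_h\to\mathcal D_{gh}$ for all $g,h\in\Gamma$. Then $\mathcal C:=\mathcal D_e$ is a tensor subcategory, and $\mathcal D$ is called a $\Gamma$-extension of $\mathcal C$. A braided tensor category is a tensor category with natural isomorphisms $c_{X,Y}:X\otimes Y\to Y\otimes X$ satisfying the two hexagon axioms. *)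

(* Defs.v *)
From HB Require Import structures.
From mathcomp Require Import all_boot all_order all_algebra all_fingroup.

Set Implicit Arguments.
Unset Strict Implicit.
Unset Printing Implicit Defensive.

Import GRing.Theory.
Local Open Scope ring_scope.

Declare Scope lincat_scope.
Delimit Scope lincat_scope with C.
Local Open Scope lincat_scope.

Record linCat (k : fieldType) := LinCat {
  ob :> Type;
  mor : ob -> ob -> lmodType k;
  catid : forall X, mor X X;
  ccomp : forall X Y Z, mor Y Z -> mor X Y -> mor X Z;
  ccomp1m : forall X Y (f : mor X Y), ccomp (catid Y) f = f;
  ccompm1 : forall X Y (f : mor X Y), ccomp f (catid X) = f;
  ccompA : forall X Y Z W (h : mor Z W) (g : mor Y Z) (f : mor X Y),
    ccomp h (ccomp g f) = ccomp (ccomp h g) f;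
  ccomp_linear_l : forall X Y Z (f : mor X Y),
    linear (fun g : mor Y Z => ccomp g f);
  ccomp_linear_r : forall X Y Z (g : mor Y Z),
    linear (fun f : mor X Y => ccomp g f)
}.

Arguments catid {k l} X.
Arguments ccomp {k l X Y Z} g f : rename.
Notation "g ∘ f" := (ccomp g f)
  (at level 40, left associativity) : lincat_scope.

Record iso (k : fieldType) (C : linCat k) (X Y : C) := Iso {
  iso_hom :> mor X Y;
  iso_inv : mor Y X;
  iso_homK : iso_inv ∘ iso_hom = catid X;
  iso_invK : iso_hom ∘ iso_inv = catid Y
}.

Section Abelian.
Variables (k : fieldType) (C : linCat k).
Implicit Types X Y Z : C.

Definition is_zero_object Z :=
  forall X, (forall f : mor X Z, f = 0) /\ (forall f : mor Z X, f = 0).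

Definition is_iso X Y (f : mor X Y) :=
  exists g : mor Y X, g ∘ f = catid X /\ f ∘ g = catid Y.

Definition is_mono X Y (f : mor X Y) :=
  forall W (u v : mor W X), f ∘ u = f ∘ v -> u = v.

Definition is_epi X Y (f : mor X Y) :=
  forall W (u v : mor Y W), u ∘ f = v ∘ f -> u = v.

Definition is_kernel K X Y (i : mor K X) (f : mor X Y) :=
  f ∘ i = 0 /\
  forall W (h : mor W X), f ∘ h = 0 -> exists! u : mor W K, i ∘ u = h.

Definition is_cokernel X Y Q (p : mor Y Q) (f : mor X Y) :=
  p ∘ f = 0 /\
  forall W (h : mor Y W), h ∘ f = 0 -> exists! u : mor Q W, u ∘ p = h.

Definition is_direct_sum (I : finType) (F : I -> C) X
    (i : forall a, mor (F a) X) (p : forall a, mor X (F a)) :=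
  [/\ forall a, p a ∘ i a = catid (F a),
      forall a b, a != b -> p b ∘ i a = 0
    & \sum_a i a ∘ p a = catid X].

Record is_abelian : Prop := IsAbelian {
  abelian_zero : exists Z, is_zero_object Z;
  abelian_sum : forall F : bool -> C, exists X i p,
    @is_direct_sum bool F X i p;
  abelian_ker : forall X Y (f : mor X Y), exists K (i : mor K X),
    is_kernel i f;
  abelian_coker : forall X Y (f : mor X Y), exists Q (p : mor Y Q),
    is_cokernel p f;
  abelian_mono : forall X Y (f : mor X Y), is_mono f ->
    exists Z (g : mor Y Z), is_kernel f g;
  abelian_epi : forall X Y (f : mor X Y), is_epi f ->
    exists Z (g : mor Z X), is_cokernel f g
}.

Definition is_simple X :=
  ~ is_zero_object X /\
  forall Y (m : mor Y X), is_mono m -> is_zero_object Y \/ is_iso m.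

(* Existence of a finite filtration with simple subquotients. *)
Inductive finite_length : C -> Prop :=
| finite_length_zero X : is_zero_object X -> finite_length X
| finite_length_ext X' X S (i : mor X' X) (p : mor X S) :
    is_kernel i p -> is_cokernel p i -> is_simple S ->
    finite_length X' -> finite_length X.

Definition is_locally_finite :=
  (forall X, finite_length X) /\
  (forall X Y, exists (n : nat) (b : 'I_n -> mor X Y),
     forall f, exists c : 'I_n -> k, f = \sum_j c j *: b j).

End Abelian.

Record monCat (k : fieldType) := MonCat {
  lincat_of :> linCat k;
  tens : lincat_of -> lincat_of -> lincat_of;
  tensm : forall (X X' Y Y' : lincat_of),
    mor X X' -> mor Y Y' -> mor (tens X Y) (tens X' Y');
  tunit : lincat_of;
  tensm_id : forall X Y, tensm (catid X) (catid Y) = catid (tens X Y);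
  tensm_comp : forall (X X' X'' Y Y' Y'' : lincat_of)
      (f' : mor X' X'') (f : mor X X') (g' : mor Y' Y'') (g : mor Y Y'),
    tensm (f' ∘ f) (g' ∘ g) = tensm f' g' ∘ tensm f g;
  tensm_linear_l : forall (X X' Y Y' : lincat_of) (g : mor Y Y'),
    linear (fun f : mor X X' => tensm f g);
  tensm_linear_r : forall (X X' Y Y' : lincat_of) (f : mor X X'),
    linear (fun g : mor Y Y' => tensm f g);
  assoc : forall X Y Z, iso (tens (tens X Y) Z) (tens X (tens Y Z));
  lunit : forall X, iso (tens tunit X) X;
  runit : forall X, iso (tens X tunit) X;
  assoc_nat : forall (X X' Y Y' Z Z' : lincat_of)
      (f : mor X X') (g : mor Y Y') (h : mor Z Z'),
    assoc X' Y' Z' ∘ tensm (tensm f g) h =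
    tensm f (tensm g h) ∘ assoc X Y Z;
  lunit_nat : forall (X X' : lincat_of) (f : mor X X'),
    lunit X' ∘ tensm (catid tunit) f = f ∘ lunit X;
  runit_nat : forall (X X' : lincat_of) (f : mor X X'),
    runit X' ∘ tensm f (catid tunit) = f ∘ runit X;
  pentagon : forall X Y Z W : lincat_of,
    assoc X Y (tens Z W) ∘ assoc (tens X Y) Z W =
    tensm (catid X) (assoc Y Z W) ∘ assoc X (tens Y Z) W
      ∘ tensm (assoc X Y Z) (catid W);
  triangle : forall X Y : lincat_of,
    tensm (catid X) (lunit Y) ∘ assoc X tunit Y = tensm (runit X) (catid Y)
}.

Arguments tunit {k m}.
Arguments assoc {k m} X Y Z.
Arguments lunit {k m} X.
Arguments runit {k m} X.
Notation "X ⊗ Y" := (tens X Y)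
  (at level 40, left associativity) : lincat_scope.
Notation "f ⊠ g" := (tensm f g)
  (at level 40, left associativity) : lincat_scope.

Section Tensor.
Variables (k : fieldType) (D : monCat k).
Implicit Types X Y Z : D.

(* ev : X' ⊗ X -> 1 and coev : 1 -> X ⊗ X' exhibit X' as a left dual of X,
   and X as a right dual of X'. *)
Definition is_duality X' X (ev : mor (X' ⊗ X) tunit) (coev : mor tunit (X ⊗ X')) :=
  runit X ∘ (catid X ⊠ ev) ∘ assoc X X' X ∘ (coev ⊠ catid X)
    ∘ iso_inv (lunit X) = catid X
  /\
  lunit X' ∘ (ev ⊠ catid X') ∘ iso_inv (assoc X' X X') ∘ (catid X' ⊠ coev)
    ∘ iso_inv (runit X') = catid X'.

Definition is_rigid :=
  forall X,
    (exists (X' : D) ev coev, @is_duality X' X ev coev) /\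
    (exists (X' : D) ev coev, @is_duality X X' ev coev).

Record is_tensor_category : Prop := IsTensorCategory {
  tensor_abelian : is_abelian D;
  tensor_locally_finite : is_locally_finite D;
  tensor_rigid : is_rigid;
  tensor_end_one : bijective (fun a : k => a *: catid (tunit : D))
}.

Record braiding := Braiding {
  braid : forall X Y, iso (X ⊗ Y) (Y ⊗ X);
  braid_nat : forall X X' Y Y' (f : mor X X') (g : mor Y Y'),
    braid X' Y' ∘ (f ⊠ g) = (g ⊠ f) ∘ braid X Y;
  hexagon1 : forall X Y Z,
    assoc Y Z X ∘ braid X (Y ⊗ Z) ∘ assoc X Y Z =
    (catid Y ⊠ braid X Z) ∘ assoc Y X Z ∘ (braid X Y ⊠ catid Z);
  hexagon2 : forall X Y Z,
    iso_inv (assoc Z X Y) ∘ braid (X ⊗ Y) Z ∘ iso_inv (assoc X Y Z) =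
    (braid X Z ⊠ catid Y) ∘ iso_inv (assoc X Z Y) ∘ (catid X ⊠ braid Y Z)
}.

Definition is_braided_tensor_category :=
  is_tensor_category /\ inhabited braiding.

End Tensor.

Definition full_sub (k : fieldType) (C : linCat k) (P : C -> Prop) : linCat k :=
  @LinCat k {X : C | P X} (fun X Y => mor (sval X) (sval Y))
    (fun X => catid (sval X)) (fun X Y Z g f => g ∘ f)
    (fun X Y f => ccomp1m f) (fun X Y f => ccompm1 f)
    (fun X Y Z W h g f => ccompA h g f)
    (fun X Y Z f => @ccomp_linear_l k C (sval X) (sval Y) (sval Z) f)
    (fun X Y Z g => @ccomp_linear_r k C (sval X) (sval Y) (sval Z) g).

Definition full_sub_iso (k : fieldType) (C : linCat k) (P : C -> Prop)
    (X Y : full_sub P) (f : iso (sval X) (sval Y)) : iso X Y :=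
  @Iso k (full_sub P) X Y (iso_hom f) (iso_inv f) (iso_homK f) (iso_invK f).

Section FullSubMon.
Variables (k : fieldType) (D : monCat k) (P : D -> Prop).
Hypothesis P_one : P tunit.
Hypothesis P_tens : forall X Y, P X -> P Y -> P (X ⊗ Y).

Let sub_tens (X Y : full_sub P) : full_sub P :=
  exist P (sval X ⊗ sval Y) (P_tens (svalP X) (svalP Y)).
Let sub_one : full_sub P := exist P tunit P_one.

Definition full_sub_mon : monCat k.
Proof.
refine (@MonCat k (full_sub P) sub_tens
  (fun X X' Y Y' f g => (f : mor (sval X) (sval X')) ⊠ g) sub_one
  _ _ _ _
  (fun X Y Z => @full_sub_iso k D P (sub_tens (sub_tens X Y) Z)
     (sub_tens X (sub_tens Y Z)) (assoc (sval X) (sval Y) (sval Z)))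
  (fun X => @full_sub_iso k D P (sub_tens sub_one X) X (lunit (sval X)))
  (fun X => @full_sub_iso k D P (sub_tens X sub_one) X (runit (sval X)))
  _ _ _ _ _).
- by move=> X Y; exact: tensm_id.
- by move=> X X' X'' Y Y' Y'' f' f g' g; exact: tensm_comp.
- by move=> X X' Y Y' g; exact: tensm_linear_l.
- by move=> X X' Y Y' f; exact: tensm_linear_r.
- by move=> X X' Y Y' Z Z' f g h; exact: assoc_nat.
- by move=> X X' f; exact: lunit_nat.
- by move=> X X' f; exact: runit_nat.
- by move=> X Y Z W; exact: pentagon.
- by move=> X Y; exact: triangle.
Defined.

End FullSubMon.

(* Components are taken replete (closed under isomorphism), so that the
   product of objects of degrees g and h, which is only determined up to
   isomorphism, lies in degree g * h. *)
Record grading (gT : finGroupType) (k : fieldType) (D : monCat k) := Grading {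
  component :> gT -> D -> Prop;
  component_replete : forall g (X Y : D),
    iso X Y -> component g X -> component g Y;
  component_abelian : forall g, is_abelian (full_sub (component g));
  component_neq0 : forall g, exists2 X, component g X & ~ is_zero_object X;
  component_orth : forall g h, g != h -> forall X Y,
    component g X -> component h Y -> forall f : mor X Y, f = 0;
  component_sum : forall X, exists (F : gT -> D) i p,
    (forall g, component g (F g)) /\ @is_direct_sum k D gT F X i p;
  component_tens : forall g h X Y,
    component g X -> component h Y -> component (g * h)%g (X ⊗ Y)
}.

Section Neutral.
Variables (gT : finGroupType) (k : fieldType) (D : monCat k).
Hypothesis tensD : is_tensor_category D.
Variable G : grading gT D.

Lemma component1_one : G 1%g tunit.
Proof.
have [one_inj one_surj] : injective (fun a : k => a *: catid (tunit : D)) /\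
    (forall f : mor (tunit : D) tunit, exists a, f = a *: catid tunit).
  case: (tensor_end_one tensD) => u uK Ku; split; first exact: can_inj uK.
  by move=> f; exists (u f); rewrite Ku.
have [F [i [p [GF [pi1 pi0 sum1]]]]] := component_sum G tunit.
have [g ig_neq0] : exists g, i g ∘ p g != 0.
  case: (pickP (fun g => i g ∘ p g != 0)) => [g ?|ip0]; first by exists g.
  have /one_inj/eqP : 1 *: catid (tunit : D) = 0 *: catid tunit.
    rewrite scale1r scale0r -sum1 big1 // => g _.
    by apply/eqP; exact: negbFE (ip0 g).
  by rewrite oner_eq0.
have ip1 : i g ∘ p g = catid tunit.
  have [a ipa] := one_surj (i g ∘ p g).
  have : (i g ∘ p g) ∘ (i g ∘ p g) = i g ∘ p g.
    by rewrite -ccompA [p g ∘ _]ccompA pi1 ccomp1m.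
  have compZl (b : k) (f : mor (tunit : D) tunit) :
      (b *: catid tunit) ∘ f = b *: f.
    have := @ccomp_linear_l k D _ _ tunit f b (catid tunit) 0.
    have := @ccomp_linear_l k D _ _ tunit f 1 0 0.
    rewrite /= !scale1r !addr0 => e0.
    have -> : (0 : mor (tunit : D) tunit) ∘ f = 0.
      by apply: (addrI ((0 : mor (tunit : D) tunit) ∘ f)); rewrite -e0 addr0.
    by rewrite addr0 ccomp1m => ->.
  rewrite ipa compZl scalerA => /one_inj/eqP.
  rewrite -subr_eq0 -[X in _ - X]mulr1 -mulrBr mulf_eq0.
  have aN0 : a != 0.
    by apply: contraNneq ig_neq0; rewrite ipa => ->; rewrite scale0r.
  by rewrite (negPf aN0) /= subr_eq0 => /eqP ->; rewrite scale1r.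
have G1 : G g tunit.
  by apply: component_replete (GF g); exact: (Iso (pi1 g) ip1).
have G11 : G (g * g)%g tunit.
  by apply: component_replete (component_tens G1 G1); exact: runit.
have [/eqP|gg] := eqVneq g (g * g)%g.
  by rewrite -{1}[g]mulg1 (inj_eq (mulgI g)) => /eqP g1; rewrite g1.
have /one_inj/eqP : 1 *: catid (tunit : D) = 0 *: catid tunit.
  rewrite scale1r scale0r; exact: (component_orth gg G1 G11).
by rewrite oner_eq0.
Qed.

Lemma component1_tens X Y : G 1%g X -> G 1%g Y -> G 1%g (X ⊗ Y).
Proof. by move=> GX GY; rewrite -[1%g]mulg1; exact: component_tens. Qed.

(* The component of degree 1 as a monoidal category: the full subcategory
   on G 1, with the tensor product, unit and constraints of D. *)
Definition neutral_component : monCat k :=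
  full_sub_mon component1_one component1_tens.

End Neutral.

(* Main.v *)
(** The neutral component inherits all structure from the ambient category by
restriction, except that finite filtrations and duals must be shown to stay
inside it.  Both follow from orthogonality of the components: an object [X] is
of degree [g] as soon as it receives no nonzero morphism from objects of other
degrees.  Subobjects of objects of degree [g] have this property (and quotients
the dual one).  So does a dual [X'] of an object [X] of degree 1: for [f] from
[Y] of degree [h != 1] to [X'], the zigzag identity makes [f] factor through
[ev ∘ (f ⊠ id)], a morphism from the degree [h] object [Y ⊗ X] to the unit,
which vanishes. *)

Require Import Defs.
From mathcomp Require Import all_boot all_order all_algebra all_fingroup.

Set Implicit Arguments.
Unset Strict Implicit.
Unset Printing Implicit Defensive.

Import GRing.Theory.
Local Open Scope ring_scope.
Local Open Scope lincat_scope.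

Lemma linear_map0 (k : fieldType) (U V : lmodType k) (f : U -> V) :
  linear f -> f 0 = 0.
(* At scalar [-1] and zero vectors, linearity reads [f 0 = - f 0 + f 0]. *)
Proof. by move=> /(_ (-1) 0 0); rewrite scaler0 addr0 scaleN1r addNr. Qed.

Section LinearCategory.
Variables (k : fieldType) (C : linCat k).
Implicit Types X Y Z : C.

Lemma ccomp0m X Y Z (f : mor X Y) : (0 : mor Y Z) ∘ f = 0.
Proof. exact: linear_map0 (@ccomp_linear_l k C X Y Z f). Qed.

Lemma ccompm0 X Y Z (g : mor Y Z) : g ∘ (0 : mor X Y) = 0.
Proof. exact: linear_map0 (@ccomp_linear_r k C X Y Z g). Qed.

Lemma ccomp_sumr (I : finType) X Y Z (g : mor Y Z) (f : I -> mor X Y) :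
  g ∘ (\sum_a f a) = \sum_a g ∘ f a.
Proof.
apply: (big_morph (fun f' : mor X Y => g ∘ f') _ (ccompm0 X g)) => u v.
by have := ccomp_linear_r g 1 u v; rewrite /= !scale1r.
Qed.

(** This criterion involves only endomorphisms of [X], so it transfers between a category and its
    full subcategories. *)
Lemma is_zero_object_id X : is_zero_object X <-> catid X = 0.
Proof.
split=> [X0|id0 Y]; first by case: (X0 X).
by split=> f; [rewrite -[f]ccomp1m id0 ccomp0m|rewrite -[f]ccompm1 id0 ccompm0].
Qed.

Lemma is_kernel_mono K X Y (i : mor K X) (f : mor X Y) :
  is_kernel i f -> is_mono i.
Proof.
case=> fi0 uniq_i W u v iuv.
have [|w [_ w_uniq]] := uniq_i W (i ∘ u); first by rewrite ccompA fi0 ccomp0m.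
by rewrite -(w_uniq u) // -(w_uniq v).
Qed.

Lemma is_cokernel_epi X Y Q (p : mor Y Q) (f : mor X Y) :
  is_cokernel p f -> is_epi p.
Proof.
case=> pf0 uniq_p W u v upv.
have [|w [_ w_uniq]] := uniq_p W (u ∘ p); first by rewrite -ccompA pf0 ccompm0.
by rewrite -(w_uniq u) // -(w_uniq v).
Qed.

End LinearCategory.

Section MonoidalCategory.
Variables (k : fieldType) (D : monCat k).
Implicit Types X Y : D.

Lemma tens0m X X' Y Y' (g : mor Y Y') : (0 : mor X X') ⊠ g = 0.
Proof. exact: linear_map0 (@tensm_linear_l k D X X' Y Y' g). Qed.

Lemma tensm0 X X' Y Y' (f : mor X X') : f ⊠ (0 : mor Y Y') = 0.
Proof. exact: linear_map0 (@tensm_linear_r k D X X' Y Y' f). Qed.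

(** Turns naturality of the unitors and the associator into naturality of their inverses, which
    occur in the zigzag identities. *)
Lemma iso_conj X Y X' Y' (a : iso X Y) (b : iso X' Y')
    (f : mor X X') (g : mor Y Y') :
  b ∘ f = g ∘ a -> f ∘ iso_inv a = iso_inv b ∘ g.
Proof.
move=> bf; rewrite -[f]ccomp1m -(iso_homK b) -[_ ∘ f]ccompA bf.
by rewrite -!ccompA iso_invK ccompm1.
Qed.

(** Compose [f] with the zigzag on [X'], then slide [f] through the inverse right unitor, [coev] and
    the inverse associator until it meets [ev]. *)
Lemma duality_factor_l X' X Y ev coev (f : mor Y X') :
  @is_duality k D X' X ev coev ->
  f = lunit X' ∘ ((ev ∘ (f ⊠ catid X)) ⊠ catid X') ∘ iso_inv (assoc Y X X')
        ∘ (catid Y ⊠ coev) ∘ iso_inv (runit Y).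
Proof.
case=> _ zigzag; rewrite -[LHS]ccomp1m -[in X in X = _]zigzag -!ccompA; congr (_ ∘ _).
rewrite -(iso_conj (runit_nat f)).
rewrite [(_ ⊠ coev) ∘ (_ ∘ _)]ccompA -tensm_comp ccomp1m ccompm1.
(* Interchange in the other order: [f] now comes after [coev] and can pass the associator. *)
have -> : f ⊠ coev = (f ⊠ catid (X ⊗ X')) ∘ (catid Y ⊠ coev).
  by rewrite -tensm_comp ccompm1 ccomp1m.
rewrite -[catid (X ⊗ X')]tensm_id -!ccompA.
rewrite [iso_inv (assoc _ _ _) ∘ (_ ∘ _)]ccompA.
rewrite -(iso_conj (assoc_nat f (catid X) (catid X'))).
by rewrite -[in RHS](ccomp1m (catid X')) tensm_comp -!ccompA.
Qed.

Lemma duality_factor_r X' X Y ev coev (f : mor Y X) :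
  @is_duality k D X' X ev coev ->
  f = runit X ∘ (catid X ⊠ (ev ∘ (catid X' ⊠ f))) ∘ assoc X X' Y
        ∘ (coev ⊠ catid Y) ∘ iso_inv (lunit Y).
Proof.
case=> zigzag _; rewrite -[LHS]ccomp1m -[in X in X = _]zigzag -!ccompA; congr (_ ∘ _).
rewrite -(iso_conj (lunit_nat f)).
rewrite [(coev ⊠ _) ∘ (_ ∘ _)]ccompA -tensm_comp ccomp1m ccompm1.
have -> : coev ⊠ f = (catid (X ⊗ X') ⊠ f) ∘ (coev ⊠ catid Y).
  by rewrite -tensm_comp ccompm1 ccomp1m.
rewrite -[catid (X ⊗ X')]tensm_id -!ccompA.
rewrite [assoc X X' X ∘ (_ ∘ _)]ccompA assoc_nat.
by rewrite -[in RHS](ccomp1m (catid X)) tensm_comp -!ccompA.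
Qed.

End MonoidalCategory.

Section Grading.
Variables (gT : finGroupType) (k : fieldType) (D : monCat k) (G : grading gT D).
Implicit Types (g h : gT) (X Y : D).

(** The identity of [X] reduces to [i g ∘ p g], so [i g] is an isomorphism and repleteness
    applies. *)
Lemma component_summand g X (F : gT -> D) i p :
    (forall h, G h (F h)) -> @is_direct_sum k D gT F X i p ->
  (forall h, h != g -> i h ∘ p h = 0) -> G g X.
Proof.
move=> GF [pi1 _ sum1] ip0; apply: component_replete (GF g).
apply: (Iso (pi1 g)).
by rewrite -sum1 (bigD1 g) //= big1 ?addr0.
Qed.

Lemma component_source g X :
  (forall h Y (f : mor Y X), h != g -> G h Y -> f = 0) -> G g X.
Proof.
move=> X0; have [F [i [p [GF sumX]]]] := component_sum G X.
apply: (component_summand GF sumX) => h hg.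
by rewrite (X0 h _ (i h) hg (GF h)) ccomp0m.
Qed.

Lemma component_target g X :
  (forall h Y (f : mor X Y), h != g -> G h Y -> f = 0) -> G g X.
Proof.
move=> X0; have [F [i [p [GF sumX]]]] := component_sum G X.
apply: (component_summand GF sumX) => h hg.
by rewrite (X0 h _ (p h) hg (GF h)) ccompm0.
Qed.

Lemma component_mono g X Y (m : mor Y X) : is_mono m -> G g X -> G g Y.
Proof.
move=> mono_m GX; apply: component_source => h W f hg GW.
by apply: mono_m; rewrite ccompm0; exact: (component_orth hg GW GX).
Qed.

Lemma component_epi g X Y (e : mor X Y) : is_epi e -> G g X -> G g Y.
Proof.
move=> epi_e GX; apply: component_target => h W f hg GW.
rewrite eq_sym in hg.
by apply: epi_e; rewrite ccomp0m; exact: (component_orth hg GX GW).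
Qed.

(** In the component, [m] is tested only on objects of degree [g]. Decomposing an arbitrary [W]
    suffices: its summands of other degrees admit only zero maps to [Y]. *)
Lemma full_sub_mono g (X Y : full_sub (G g)) (m : mor Y X) :
  is_mono m -> is_mono (C := D) (X := sval Y) (Y := sval X) m.
Proof.
move=> mono_m W u v muv.
have [F [i [p [GF [_ _ sum1]]]]] := component_sum G W.
suff ui h : u ∘ i h = v ∘ i h.
  have linW w : w = \sum_h (w ∘ i h) ∘ p h :> mor W (sval Y).
    by rewrite -[LHS]ccompm1 -sum1 ccomp_sumr; apply: eq_bigr => h _; rewrite ccompA.
  by rewrite (linW u) (linW v); apply: eq_bigr => h _; rewrite ui.
have [hg|hg] := eqVneq h g; last first.
  have orthF (f : mor (F h) (sval Y)) : f = 0.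
    exact: (component_orth hg (GF h) (svalP Y)).
  by rewrite (orthF (u ∘ i h)) (orthF (v ∘ i h)).
have GFg : G g (F h) by rewrite -hg.
apply: (mono_m (exist _ (F h) GFg) (u ∘ i h) (v ∘ i h)).
by rewrite /= !ccompA muv.
Qed.

Lemma full_sub_is_simple g X (GX : G g X) :
  is_simple X -> is_simple (exist _ X GX : full_sub (G g)).
Proof.
case=> XN0 simpleX; split=> [/is_zero_object_id/= X0|[Y GY] m mono_m].
  by apply: XN0; apply/is_zero_object_id.
case: (simpleX Y m (full_sub_mono mono_m)) => [Y0|iso_m]; last by right.
by left; apply/is_zero_object_id; move/is_zero_object_id: Y0.
Qed.

(** The filtration in [D] already lies in the component, as its terms are iterated subobjects of [X]
    and its factors quotients of those; exactness is tested there on fewer objects. *)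
Lemma full_sub_finite_length g X (GX : G g X) :
  finite_length X -> finite_length (exist _ X GX : full_sub (G g)).
Proof.
move=> finX; elim: finX GX => {X} [X X0|X' X S i p ker_i coker_p simpleS _ IH] GX.
  by apply/finite_length_zero/is_zero_object_id; move/is_zero_object_id: X0.
have GX' := component_mono (is_kernel_mono ker_i) GX.
have GS := component_epi (is_cokernel_epi coker_p) GX.
apply: (@finite_length_ext _ (full_sub (G g)) (exist _ X' GX') (exist _ X GX)
  (exist _ S GS) i p); [| |exact: full_sub_is_simple|exact: IH].
- by case: ker_i => pi0 ker_i; split=> // -[W GW] h; exact: ker_i.
- by case: coker_p => pi0 coker_p; split=> // -[W GW] h; exact: coker_p.
Qed.

Lemma full_sub_locally_finite g :
  is_locally_finite D -> is_locally_finite (full_sub (G g)).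
Proof.
case=> finD homD; split=> [[X GX]|X Y]; first exact: full_sub_finite_length.
exact: homD.
Qed.

Hypothesis tensD : is_tensor_category D.

Lemma component1_dual_l X' X ev coev :
  @is_duality k D X' X ev coev -> G 1%g X -> G 1%g X'.
Proof.
move=> dualX GX; apply: component_source => h Y f h1 GY.
rewrite (duality_factor_l f dualX).
have GYX : G h (Y ⊗ X) by rewrite -[h]mulg1; exact: component_tens.
rewrite (component_orth h1 GYX (component1_one tensD G) (ev ∘ _)).
by rewrite tens0m ccompm0 !ccomp0m.
Qed.

Lemma component1_dual_r X' X ev coev :
  @is_duality k D X' X ev coev -> G 1%g X' -> G 1%g X.
Proof.
move=> dualX GX'; apply: component_source => h Y f h1 GY.
rewrite (duality_factor_r f dualX).
have GXY : G h (X' ⊗ Y) by rewrite -[h]mul1g; exact: component_tens.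
rewrite (component_orth h1 GXY (component1_one tensD G) (ev ∘ _)).
by rewrite tensm0 ccompm0 !ccomp0m.
Qed.

Lemma neutral_component_rigid : is_rigid (neutral_component tensD G).
Proof.
case=> X GX; have [[Y [ev [coev dualY]]] [Z [ev' [coev' dualZ]]]] :=
  tensor_rigid tensD X.
split.
- by exists (exist _ Y (component1_dual_l dualY GX)), ev, coev.
- by exists (exist _ Z (component1_dual_r dualZ GX)), ev', coev'.
Qed.

Lemma neutral_component_tensor : is_tensor_category (neutral_component tensD G).
Proof.
split; first exact: (component_abelian G 1%g).
- exact: full_sub_locally_finite (tensor_locally_finite tensD).
- exact: neutral_component_rigid.
- exact: tensor_end_one tensD.
Qed.

(** By fullness the braiding of [D] restricts; the tensor product and associator are those of [D],
    so naturality and the hexagons hold verbatim. *)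
Definition neutral_component_braiding (B : braiding D) :
  braiding (neutral_component tensD G).
Proof.
pose br (X Y : neutral_component tensD G) : iso (X ⊗ Y) (Y ⊗ X) :=
  @full_sub_iso k D (G 1%g) (X ⊗ Y) (Y ⊗ X) (braid B (sval X) (sval Y)).
apply: (@Braiding k (neutral_component tensD G) br).
- by move=> X X' Y Y' f g; exact: (braid_nat B).
- by move=> X Y Z; exact: (hexagon1 B).
- by move=> X Y Z; exact: (hexagon2 B).
Defined.

End Grading.

Theorem theorem2p6
  (k : closedFieldType) (char0 : [pchar k]%R =i pred0)
  (Γ : finGroupType)
  (D : monCat k) (tensD : is_tensor_category D)
  (G : grading Γ D) :
  is_braided_tensor_category D ->
  is_braided_tensor_category (neutral_component tensD G).
Proof.
case=> _ [B]; split; first exact: neutral_component_tensor.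
by split; exact: neutral_component_braiding.
Qed.
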